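(* Let $x,y$ be positive integers and let $n$ be an integer. The number of ways (disregarding order and allowing repetition) of writing $n$ (mod $y$) as the sum of $x$ integers of the set $\{0,1,\dots,y-1\}$ is equal to the number of ways (disregarding order and allowing repetition) of writing $n$ (mod $x$) as the sum of $y$ integers of the set $\{0,1,\dots,x-1\}$.
   Context: In other words, the first number is the number of multisets of size $x$ with elements from $\{0,1,\dots,y-1\}$ whose sum is congruent to $n$ modulo $y$, and the second is the number of multisets of size $y$ with elements from $\{0,1,\dots,x-1\}$ whose sum is congruent to $n$ modulo $x$. *)

(* Defs.v *)
From mathcomp Require Import all_boot all_algebra.
From mathcomp Require Import finmap multiset.

Set Implicit Arguments.
Unset Strict Implicit.
Unset Printing Implicit Defensive.

Local Open Scope fset_scope.
Local Open Scope mset_scope.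
Local Open Scope ring_scope.

(* The multisets of size k over {0, ..., m - 1} with sum congruent to n mod m.
   The tuples only serve to present them as a finite set: [seq_mset] forgets
   the order, and [in_mset_sums] gives the membership test. *)
Definition mset_sums (k m : nat) (n : int) : {fset {mset 'I_m}} :=
  [fset seq_mset (val t) | t : k.-tuple 'I_m
     & (\sum_(i <- val t) (val i)%:Z == n %[mod m%:Z])%Z].

Lemma in_mset_sums (k m : nat) (n : int) (A : {mset 'I_m}) :
  (A \in mset_sums k m n) =
  (size A == k) && (\sum_(i <- A) (val i)%:Z == n %[mod m%:Z])%Z.
Proof.
apply/imfsetP/andP => [[t /= tP ->]|[sA AP]].
  have pt := perm_eq_seq_mset (val t).
  by rewrite (perm_size pt) size_tuple eqxx (perm_big _ pt).
by exists (Tuple sA); rewrite //= seq_mset_id.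
Qed.

(* Main.v *)
Require Import Defs.
From mathcomp Require Import all_boot all_algebra.
From mathcomp Require Import finmap.
From mathcomp Require Import multiset zify.

(** Write M(k, m, n) for the number of multisets of size k over {0, ..., m - 1}
    with sum congruent to n modulo m, and let g be the greatest common divisor
    of k and m.

    Adding 1 modulo m to every element of a multiset raises its sum by k modulo
    m, so M(k, m, n) depends only on n modulo g.  Hence, if U(k, m, n) counts
    the multisets whose sum is congruent to n modulo g only, the m / g residues
    modulo m above n contribute equally and g U(k, m, n) = m M(k, m, n)
    ([card_sorted_tuples_gcd]).  What remains is the reciprocity
    k U(k, m, n) = m U(m, k, n) ([card_sorted_tuples_exchange]).

    For this, put N = k + m and consider the family P of k-element subsets S of
    Z/N whose sum lies in a fixed class modulo g.  A translation of Z/N adds a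
    multiple of k to that sum modulo N, and g divides both k and N, so P is
    stable under translation.  Counting the pairs of S in P and an element
    of S, every element of Z/N is used equally often, so that N times the number
    of S in P containing 0 is k |P| ([card_rotation_marked]), and therefore k
    times the number of S avoiding 0 is m times the number of S containing 0.

    A k-subset {p_1 < ... < p_k} of {1, ..., N - 1} is the same thing as a
    multiset i_1 <= ... <= i_k over {0, ..., m - 1}, through p_j = i_j + j
    ([card_stair_image]); the sums differ by a constant, so with the right
    choice of class the S in P avoiding 0 are counted by U(k, m, n).  The S
    containing 0 have complements of size m which avoid 0, and the same
    bijection counts these by U(m, k, - n), because S and its complement have
    a constant total sum.  Finally the reflection i -> k - 1 - i gives
    U(m, k, - n) = U(m, k, n).

    Multisets are handled as weakly increasing tuples, which form an ordinary
    finite type. *)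

Set Implicit Arguments.
Unset Strict Implicit.
Unset Printing Implicit Defensive.

Import GRing.Theory.

(** * Multisets as sorted tuples *)

(** The condition on the sum is an arbitrary predicate because congruences to
    several moduli, and with various offsets, have to be compared. *)
Definition sorted_tuples (k m : nat) (P : pred nat) : {set k.-tuple 'I_m} :=
  [set t : k.-tuple 'I_m |
     sorted leq (map val t) && P (\sum_(i <- t) (i : nat))].

Lemma eq_card_sorted_tuples k m (P Q : pred nat) :
  P =1 Q -> #|sorted_tuples k m P| = #|sorted_tuples k m Q|.
Proof. by move=> eqPQ; apply: eq_card => t; rewrite !inE eqPQ. Qed.

Lemma sorted_val_eq m (s1 s2 : seq 'I_m) :
  sorted leq (map val s1) -> sorted leq (map val s2) -> perm_eq s1 s2 ->
  s1 = s2.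
Proof.
move=> ss1 ss2 eq12; apply: (inj_map val_inj).
by apply: (sorted_eq leq_trans anti_leq) => //; apply: perm_map.
Qed.

Definition sort_ord k m (t : k.-tuple 'I_m) : k.-tuple 'I_m :=
  [tuple of sort (relpre val leq) t].

Lemma sort_ord_perm k m (t : k.-tuple 'I_m) : perm_eq (sort_ord t) t.
Proof. by rewrite perm_sort. Qed.

Lemma sort_ord_sorted k m (t : k.-tuple 'I_m) :
  sorted leq (map val (sort_ord t)).
Proof. by rewrite sorted_map sort_sorted // => i j; apply: leq_total. Qed.

Lemma card_mset_sums k m (n : int) :
  #|` mset_sums k m n|%fset =
  #|sorted_tuples k m (fun s => (Posz s == n %[mod Posz m])%Z)|.
Proof.
set P := fun s : nat => _.
have sumE (s : seq 'I_m) :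
    (\sum_(i <- s) Posz (val i))%R = Posz (\sum_(i <- s) (i : nat)).
  by rewrite (big_morph Posz PoszD (erefl _)).
pose f (t : k.-tuple 'I_m) := seq_mset (val t).
have injf : {in sorted_tuples k m P &, injective f}.
  move=> t u; rewrite !inE => /andP[st _] /andP[su _] eq_f.
  by apply/val_inj/sorted_val_eq => //; apply/eq_seq_msetP.
suff -> : mset_sums k m n = [fset f t | t in sorted_tuples k m P]%fset.
  rewrite card_in_imfset // -(card_uniqP (enum_finmem_uniq _)).
  by apply: eq_card => t; rewrite enum_finmemE.
apply/fsetP => A; rewrite in_mset_sums sumE.
apply/andP/imfsetP => [[sA AP] | [t /=]]; last first.
  rewrite inE => /andP[_ Pt] ->; have pt := perm_eq_seq_mset t.
  by rewrite (perm_size pt) size_tuple eqxx (perm_big _ pt).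
have pt := sort_ord_perm (Tuple sA); exists (sort_ord (Tuple sA)).
  by rewrite inE sort_ord_sorted (perm_big _ pt).
by rewrite /f -[LHS]seq_mset_id; apply/esym/eq_seq_msetP.
Qed.

(** A relabelling of the alphabet acts injectively on multisets; it serves below
    with the cyclic shift and with the reflection. *)
Lemma leq_card_sorted_tuples_map k m (h : 'I_m -> 'I_m) (P Q : pred nat) :
    injective h ->
    (forall t : k.-tuple 'I_m, P (\sum_(i <- t) (i : nat)) ->
                               Q (\sum_(i <- t) (h i : nat))) ->
  #|sorted_tuples k m P| <= #|sorted_tuples k m Q|.
Proof.
move=> inj_h hPQ.
pose f (t : k.-tuple 'I_m) := sort_ord [tuple of map h t].
have injf : {in sorted_tuples k m P &, injective f}.
  move=> t u; rewrite !inE => /andP[st _] /andP[su _] eq_f.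
  apply/val_inj/sorted_val_eq => //; apply: (perm_map_inj inj_h).
  rewrite -(perm_sort (relpre val leq)) perm_sym.
  by rewrite -(perm_sort (relpre val leq)); move/(congr1 val): eq_f => /= ->.
rewrite -(card_in_imset injf); apply/subset_leq_card/subsetP.
move=> _ /imsetP[t + ->]; rewrite !inE => /andP[_ Pt].
by rewrite sort_ord_sorted (perm_big _ (sort_ord_perm _)) big_map hPQ.
Qed.

(** * Dependence on the residue modulo the gcd *)

Definition sorted_residue k m n :=
  sorted_tuples k m (fun s => s == n %[mod m]).

(** Each of the k elements is replaced by its cyclic successor, which adds 1 to
    it modulo m. *)
Lemma leq_card_shift k m n :
  #|sorted_residue k m n| <= #|sorted_residue k m (n + k)|.
Proof.
apply: (@leq_card_sorted_tuples_map _ _ (@ordS m)).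
  exact: (can_inj (@ordSK _)).
move=> t /eqP sum_t; apply/eqP.
rewrite [LHS]modn_summ; under eq_bigr do rewrite -addn1.
by rewrite big_split /= sum1_size size_tuple -modnDml sum_t modnDml.
Qed.

Lemma eq_sorted_residue k m n n' :
  n = n' %[mod m] -> #|sorted_residue k m n| = #|sorted_residue k m n'|.
Proof. by move=> eq_n; apply: eq_card_sorted_tuples => s; rewrite eq_n. Qed.

Lemma leq_card_shifts k m n a :
  #|sorted_residue k m n| <= #|sorted_residue k m (n + a * k)|.
Proof.
elim: a => [|a IHa]; first by rewrite mul0n addn0.
by apply: leq_trans IHa _; rewrite mulSn [k + _]addnC addnA leq_card_shift.
Qed.

(** By Bezout some multiple of k is congruent to - gcd(m, k) modulo m, so
    shifting that many times cancels one summand gcd(m, k). *)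
Lemma leq_card_gcd_shifts k m n c :
  0 < m ->
  #|sorted_residue k m (n + c * gcdn m k)| <= #|sorted_residue k m n|.
Proof.
move=> m_gt0; elim: c => [|c IHc]; first by rewrite mul0n addn0.
apply: leq_trans IHc; have [a _ dvd_m] := Bezoutl k m_gt0.
apply: leq_trans (leq_card_shifts k m _ a) _.
rewrite (@eq_sorted_residue _ _ _ (n + c * gcdn m k)) //.
rewrite mulSn [gcdn m k + _]addnC addnA -addnA -modnDmr (eqP dvd_m).
by rewrite addn0.
Qed.

(** Descending from n by multiples of the gcd gives one inequality; the other
    one comes from descending to n from a larger number that is congruent
    modulo m to the remainder of n. *)
Lemma card_sorted_residue_gcd k m n n' :
  0 < m -> n = n' %[mod gcdn m k] ->
  #|sorted_residue k m n| = #|sorted_residue k m n'|.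
Proof.
move=> m_gt0; set g := gcdn m k => eq_n.
suff red a : #|sorted_residue k m a| = #|sorted_residue k m (a %% g)|.
  by rewrite red eq_n -red.
set c := a %/ g; have aE : a = a %% g + c * g by rewrite addnC -divn_eq.
apply/eqP; rewrite eqn_leq {1}aE leq_card_gcd_shifts //=.
(* Since m = 1 + m.-1, the target a + c * m.-1 * g equals a %% g + c * g * m. *)
rewrite (@eq_sorted_residue _ _ (a %% g) (a + (c * m.-1) * g)).
  exact: leq_card_gcd_shifts.
have -> : a + c * m.-1 * g = (c * g) * m + a %% g.
  by rewrite {1}aE; case: (m) m_gt0 => // m' _; nia.
by rewrite modnMDl.
Qed.

Lemma count_residue g q n : 0 < g ->
  \sum_(j < q * g) (j == n %[mod g]) = q.
Proof.
move=> g_gt0; rewrite -(big_mkord predT (fun j => (j == n %[mod g]) : nat)).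
elim: q => [|q IHq]; first by rewrite big_geq.
rewrite mulSn addnC (big_cat_nat (leq0n _) (leq_addr _ _)) /= IHq.
rewrite -{1}[q * g]add0n big_addn addKn big_mkord.
rewrite (bigD1 (Ordinal (ltn_pmod n g_gt0))) //= big1 => [|j].
  by rewrite [_ + q * g]addnC modnMDl modn_mod eqxx addn0 addn1.
rewrite -val_eqE /= [_ + q * g]addnC modnMDl [j %% g]modn_small //.
by move=> /negbTE ->.
Qed.

(** The sums congruent to n modulo the gcd split into m / gcd classes modulo m,
    all of which are equally frequent by [card_sorted_residue_gcd]. *)
Lemma card_sorted_tuples_gcd k m n :
  0 < m ->
  gcdn m k * #|sorted_tuples k m (fun s => s == n %[mod gcdn m k])| =
  m * #|sorted_residue k m n|.
Proof.
move=> m_gt0; set g := gcdn m k.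
have g_gt0 : 0 < g by rewrite gcdn_gt0 m_gt0.
have dvd_gm : g %| m := dvdn_gcdl m k.
have mE : m = m %/ g * g by rewrite divnK.
suff -> : #|sorted_tuples k m (fun s => s == n %[mod g])| =
          m %/ g * #|sorted_residue k m n|.
  by rewrite mulnA [g * _]mulnC -mE.
pose r (t : k.-tuple 'I_m) :=
  Ordinal (ltn_pmod (\sum_(i <- t) (i : nat)) m_gt0).
rewrite -sum1_card (partition_big r predT) //=.
rewrite -[in RHS](count_residue (m %/ g) n g_gt0) -mE big_distrl /=.
apply: eq_bigr => j _; rewrite sum1dep_card.
have [eq_j | neq_j] := eqVneq (j %% g) (n %% g).
  rewrite mul1n -(card_sorted_residue_gcd m_gt0 eq_j).
  apply: eq_card => t; rewrite !inE -andbA -val_eqE /= [j %% m]modn_small //.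
  case: (_ %% m =P (j : nat)) => [jE|_]; last by rewrite !andbF.
  by rewrite -(modn_dvdm (\sum_(i <- t) _) dvd_gm) jE eq_j eqxx.
rewrite mul0n; apply/eqP; rewrite cards_eq0; apply/eqP/setP => t.
rewrite !inE -andbA -val_eqE /=; apply/negP => /and3P[_ + /eqP jE].
by rewrite -(modn_dvdm (\sum_(i <- t) _) dvd_gm) jE (negbTE neq_j).
Qed.

(** Reflecting i to m - 1 - i turns a sum s into k (m - 1) - s, which is
    congruent to - s modulo g. *)
Lemma card_sorted_tuples_opp k m n g : 0 < m -> g %| k -> g %| m ->
  #|sorted_tuples k m (fun s => g %| s + n)| =
  #|sorted_tuples k m (fun s => s == n %[mod g])|.
Proof.
move=> m_gt0 gk gm.
have sum_rev (t : k.-tuple 'I_m) :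
    g %| \sum_(i <- t) (rev_ord i : nat) + \sum_(i <- t) (i : nat).
  rewrite -big_split /= (eq_bigr (fun=> m.-1)) => [|i _]; last first.
    by have := ltn_ord i; lia.
  by rewrite big_const_seq count_predT size_tuple iter_addn_0 dvdn_mull.
apply/eqP; rewrite eqn_leq; apply/andP; split;
  apply: (leq_card_sorted_tuples_map (@rev_ord_inj m)) => t;
  have := sum_rev t; move: (\sum_(i <- t) _) (\sum_(i <- t) _) => a b.
  move=> gba gan; rewrite -(eqn_modDr a) [n + a]addnC.
  by rewrite (eqP gba) (eqP gan).
by move=> gba /eqP an; rewrite /dvdn -modnDmr -an modnDmr.
Qed.

(** * Translation-invariant families of subsets *)

(** Double counting of the pairs (S, a) with a in S: translation by b - a sends
    the members of P through a to members through b, so every point lies in as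
    many members of P as 0 does. *)
Lemma card_rotation_marked (T : finZmodType) (P : {set {set T}}) k :
    (forall S, S \in P -> #|S| = k) ->
    (forall S (a : T), S \in P -> [set (x + a)%R | x in S] \in P) ->
  #|T| * #|[set S in P | 0%R \in S]| = k * #|P|.
Proof.
move=> cardP rotP; pose Q (a : T) := [set S in P | a \in S].
have leQ a b : #|Q a| <= #|Q b|.
  rewrite -(card_imset _ (imset_inj (addIr (b - a)%R))).
  apply/subset_leq_card/subsetP => _ /imsetP[S + ->].
  rewrite !inE => /andP[PS Sa]; rewrite rotP //=.
  by apply/imsetP; exists a; rewrite // addrC subrK.
have -> : k * #|P| = \sum_(S in P) #|S|.
  by rewrite (eq_bigr (fun=> k)) // sum_nat_const mulnC.
rewrite -sum_nat_const; under [RHS]eq_bigr do rewrite -sum1_card.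
rewrite [RHS](exchange_big_dep predT) //=; apply: eq_bigr => a _.
rewrite sum1dep_card; apply/eqP; rewrite eqn_leq.
by apply/andP; split; apply: leQ.
Qed.

(** * Multisets as subsets avoiding 0 *)

Section Staircase.
Variables k m N : nat.
Hypothesis defN : k + m = N.
Implicit Type t : k.-tuple 'I_m.

(* The index j starts at 0, so adding j.+1 keeps 0 out of the image. *)
Lemma stair_subproof t (j : 'I_k) : j.+1 + tnth t j < N.
Proof. by rewrite -defN -addnS leq_add. Qed.

Definition stair t j : 'I_N := Ordinal (stair_subproof t j).

Definition stair_set t : {set 'I_N} := [set stair t j | j : 'I_k].

Lemma stair_ltn t (i j : 'I_k) :
  sorted leq (map val t) -> i < j -> stair t i < stair t j.
Proof.
move=> st ij; rewrite /= -addSn leq_add //.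
have jt : j < size (map val t) by rewrite size_map size_tuple.
have it := ltn_trans ij jt.
have := sorted_leq_nth leq_trans leqnn 0 st _ _ it jt (ltnW ij).
by rewrite !(nth_map (tnth t i)) -?tnth_nth // -(size_map val).
Qed.

Lemma stair_inj t : sorted leq (map val t) -> injective (stair t).
Proof.
move=> st i j eq_ij; apply/val_inj; case: (ltngtP i j) => // /(stair_ltn st).
  by rewrite eq_ij ltnn.
by rewrite eq_ij ltnn.
Qed.

(** The set determines the strictly increasing list of its elements, and
    removing the staircase 1, 2, ..., k from that list gives back the tuple. *)
Lemma stair_set_inj :
  {in [pred t : k.-tuple 'I_m | sorted leq (map val t)] &, injective stair_set}.
Proof.
move=> t u; rewrite !inE => st su eq_tu.
pose s v := [seq val (stair v j) | j <- enum 'I_k].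
have sorted_s (v : k.-tuple _) : sorted leq (map val v) -> sorted ltn (s v).
  move=> sv; rewrite sorted_map.
  apply: (@sub_sorted _ (relpre val ltn)) => [i j /(stair_ltn sv)//|].
  by rewrite -sorted_map val_enum_ord iota_ltn_sorted.
have mem_s (v : k.-tuple _) : s v =i map val (enum (stair_set v)).
  move=> p; apply/mapP/mapP => [[j _ ->] | [q]].
    by exists (stair v j); rewrite // mem_enum imset_f.
  by rewrite mem_enum => /imsetP[j _ ->] ->; exists j; rewrite ?mem_enum.
have eq_s : s t = s u.
  apply: (irr_sorted_eq ltn_trans ltnn); rewrite ?sorted_s // => p.
  by rewrite !mem_s eq_tu.
apply: eq_from_tnth => j; apply/val_inj/(@addnI j.+1).
by move/eq_in_map: eq_s => /(_ j); rewrite mem_enum => /(_ isT).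
Qed.

Lemma card_stair_set t : sorted leq (map val t) -> #|stair_set t| = k.
Proof. by move=> st; rewrite card_imset ?card_ord //; apply: stair_inj. Qed.

Lemma sum_stair_set t : sorted leq (map val t) ->
  \sum_(p in stair_set t) (p : nat) = \sum_(i <- t) (i : nat) + 'C(k.+1, 2).
Proof.
move=> st; rewrite big_imset /=; last by move=> ? ? _ _; apply: stair_inj.
rewrite big_split /= addnC big_tuple; congr (_ + _).
by rewrite -bin2_sum big_mkord big_ord_recl add0n.
Qed.

(** The staircase map hits every k-subset avoiding 0: it is injective, and both
    sides have 'C(N - 1, k) elements when the sum is unrestricted. *)
Lemma card_stair_image (z : 'I_N) (Q : pred nat) :
  0 < m -> val z = 0 ->
  #|[set S : {set 'I_N} |
       [&& #|S| == k, z \notin S & Q (\sum_(p in S) (p : nat))]]| =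
  #|sorted_tuples k m (fun s => Q (s + 'C(k.+1, 2)))|.
Proof.
move=> m_gt0 z0.
pose sortedT := [set t : k.-tuple 'I_m | sorted leq (map val t)].
have injT : {in sortedT &, injective stair_set}.
  by move=> t u; rewrite !inE => st su; apply: stair_set_inj.
have z_notin t : z \notin stair_set t.
  by apply/imsetP => -[j _ /(congr1 val)]; rewrite z0.
have imT : stair_set @: sortedT =
           [set S : {set 'I_N} | S \subset [set~ z] & #|S| == k].
  apply/eqP; rewrite eqEcard; apply/andP; split.
    apply/subsetP => _ /imsetP[t + ->]; rewrite !inE => st.
    by rewrite card_stair_set // eqxx andbT subsetC sub1set inE z_notin.
  rewrite cards_draws cardsC1 card_ord (card_in_imset injT).
  rewrite /sortedT -defN; case: (m) m_gt0 => // m' _.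
  by rewrite addnS card_sorted_tuples.
have /card_in_imset <- : {in sorted_tuples k m (fun s => Q (s + 'C(k.+1, 2))) &,
                          injective stair_set}.
  by move=> t u; rewrite !inE => /andP[st _] /andP[su _]; apply: stair_set_inj.
apply: eq_card => S; rewrite inE; apply/and3P/imsetP => [[cS zS QS]|[t]].
  have : S \in stair_set @: sortedT.
    by rewrite imT inE cS andbT subsetC sub1set inE.
  case/imsetP => t; rewrite inE => st SE; exists t => //.
  by rewrite inE st -sum_stair_set // -SE.
rewrite inE => /andP[st Qt] ->.
by rewrite card_stair_set // eqxx z_notin sum_stair_set.
Qed.

End Staircase.

(** * Reciprocity *)

(** Modulo a common divisor of a and b, the sum 'C(a + b, 2) of all elements of
    Z/(a + b) is thus the sum of the offsets 'C(a.+1, 2) and 'C(b.+1, 2) of the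
    two staircase maps, so no offset survives complementation. *)
Lemma bin2D a b : 'C(a + b, 2) + (a + b) = 'C(a.+1, 2) + 'C(b.+1, 2) + a * b.
Proof.
elim: b => [|b IHb]; first by rewrite !addn0 muln0 addn0 binS bin1.
by rewrite addnS [in LHS]binS ['C(b.+2, 2)]binS !bin1; lia.
Qed.

(** Both sides count, up to the same factor, the translation-invariant family of
    k-subsets of Z/(k + m) whose sum has a given residue modulo g, according to
    whether they avoid 0 (left) or contain 0 (right, through complements). *)
Lemma card_sorted_tuples_exchange k m n g : 0 < k -> 0 < m ->
    g %| k -> g %| m ->
  k * #|sorted_tuples k m (fun s => s == n %[mod g])| =
  m * #|sorted_tuples m k (fun s => s == n %[mod g])|.
Proof.
move=> k_gt0 m_gt0 gk gm.
case defN: (k + m) => [|N']; first by rewrite -(prednK k_gt0) in defN.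
set N := N'.+1 in defN; pose c := n + 'C(k.+1, 2).
pose P := [set S : {set 'I_N} |
             (#|S| == k) && (\sum_(p in S) (p : nat) == c %[mod g])].
have gN : g %| N by rewrite -defN dvdn_add.
have cardP S : S \in P -> #|S| = k by rewrite inE => /andP[/eqP].
have rotP S (a : 'I_N) : S \in P -> [set (x + a)%R | x in S] \in P.
  rewrite !inE => /andP[/eqP cardS /eqP <-].
  rewrite card_imset ?cardS ?eqxx /=; last exact: addIr.
  rewrite big_imset /=; last by move=> x y _ _; apply: addIr.
  rewrite -modn_summ; under eq_bigr do rewrite modn_dvdm //.
  by rewrite modn_summ big_split /= sum_nat_const cardS -modnDmr
             (eqP (dvdn_mulr _ gk)) addn0.
have marked := card_rotation_marked cardP rotP; rewrite card_ord in marked.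
set W1 := [set S in P | _] in marked.
pose W0 := [set S in P | 0%R \notin S].
have cardW : #|P| = #|W1| + #|W0|.
  rewrite -(cardsID [set S : {set 'I_N} | 0%R \in S]).
  by congr (_ + _); apply: eq_card => S; rewrite !inE // andbC.
(* The offset in c is the sum of the staircase 1, ..., k, so it cancels here. *)
have W0E : #|W0| = #|sorted_tuples k m (fun s => s == n %[mod g])|.
  transitivity #|sorted_tuples k m
                   (fun s => s + 'C(k.+1, 2) == c %[mod g])|; last first.
    by apply: eq_card_sorted_tuples => s; rewrite eqn_modDr.
  rewrite -(card_stair_image defN (z := 0%R)
              (fun s => s == c %[mod g]) m_gt0) //.
  by apply: eq_card => S; rewrite !inE -andbA [(_ \notin _) && _]andbC.
have W1E : #|W1| = #|sorted_tuples m k (fun s => s == n %[mod g])|.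
  rewrite -(card_sorted_tuples_opp _ k_gt0 gm gk).
  have defN' : m + k = N by rewrite addnC.
  transitivity #|sorted_tuples m k
        (fun s => s + 'C(m.+1, 2) + c == 'C(N, 2) %[mod g])|; last first.
    apply: eq_card_sorted_tuples => s.
    have -> : s + 'C(m.+1, 2) + c = 'C(m.+1, 2) + 'C(k.+1, 2) + (s + n).
      by rewrite /c; lia.
    have bin2 : 'C(N, 2) = 'C(m.+1, 2) + 'C(k.+1, 2) %[mod g].
      transitivity (('C(N, 2) + N) %% g).
        by rewrite -modnDmr (eqP gN) addn0.
      rewrite -[in LHS]defN' bin2D.
      by rewrite -modnDmr (eqP (dvdn_mulr _ gm)) addn0.
    by rewrite -[in LHS]modnDml -bin2 modnDml -{2}['C(N, 2)]addn0 eqn_modDl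
               mod0n.
  rewrite -(card_stair_image defN' (z := 0%R)
              (fun s => s + c == 'C(N, 2) %[mod g]) k_gt0) //.
  (* Complementation exchanges the two sides of the count. *)
  rewrite -(card_imset _ (can_inj (@setCK 'I_N))); apply: eq_card => T.
  have -> : (T \in [set ~: S | S in W1]) = (~: T \in W1).
    apply/imsetP/idP => [[S WS ->] | WT]; first by rewrite setCK.
    by exists (~: T); rewrite ?setCK.
  have sumT : \sum_(p in T) (p : nat) + \sum_(p in ~: T) (p : nat) = 'C(N, 2).
    rewrite -bin2_sum big_mkord [RHS](bigID (mem T)) /=.
    by congr (_ + _); apply: eq_bigl => p; rewrite inE.
  rewrite !inE -sumT eqn_modDl [c %% g == _]eq_sym -andbA.
  rewrite [_ && (0%R \notin _)]andbC; congr (_ && _).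
  have cT : #|T| + #|~: T| = m + k by rewrite cardsC card_ord defN'.
  by apply/eqP/eqP; lia.
rewrite -W0E -W1E; apply: (@addnI (k * #|W1|)).
by rewrite -mulnDr -cardW -marked -mulnDl defN.
Qed.

Lemma eq_mset_sums k m (n n' : int) :
  (n = n' %[mod Posz m])%Z -> mset_sums k m n = mset_sums k m n'.
Proof.
by move=> eq_n; apply/fsetP => A; rewrite !in_mset_sums eq_n.
Qed.

Theorem corollary1 (x y : nat) (n : int) (x_gt0 : 0 < x) (y_gt0 : 0 < y) :
  #|` mset_sums x y n|%fset = #|` mset_sums y x n|%fset.
Proof.
(* A natural representative of n that serves both moduli x and y. *)
pose a := absz (n %% Posz (x * y))%Z.
have aE : Posz a = (n %% Posz (x * y))%Z.
  by rewrite gez0_abs // modz_ge0 // -lt0n muln_gt0 x_gt0.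
have card_res k m : m %| x * y ->
    #|` mset_sums k m n|%fset = #|sorted_residue k m a|.
  move=> dvd_m; rewrite (@eq_mset_sums _ _ n a).
    rewrite card_mset_sums; apply: eq_card_sorted_tuples => s.
    by rewrite !modz_nat.
  rewrite aE; apply/eqP; rewrite eqz_mod_dvd.
  rewrite {1}(divz_eq n (Posz (x * y))) addrK.
  exact: dvdz_mull.
rewrite (card_res x y (dvdn_mull _ (dvdnn _))).
rewrite (card_res y x (dvdn_mulr _ (dvdnn _))).
have := card_sorted_tuples_exchange a x_gt0 y_gt0
          (dvdn_gcdr y x) (dvdn_gcdl y x).
(* After multiplication by the gcd, each U becomes a multiple of the M with the
   same arguments, and the total factor is x * y on either side. *)
move/(congr1 (muln (gcdn y x))); rewrite mulnCA card_sorted_tuples_gcd //.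
rewrite [in RHS]mulnCA [in RHS]gcdnC card_sorted_tuples_gcd // => eqM.
apply/eqP; rewrite -(eqn_pmul2l y_gt0) -(eqn_pmul2l x_gt0) eqM.
by rewrite mulnCA.
Qed.
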